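(* Let $m,n\in\mathbb{N}$. Then $$\sum_{\substack{\sum i y_i=m\\ \sum y_i\text{ even}}}\prod_{i=1}^{m}\frac{1}{y_i!}\left(\frac{n}{i}\right)^{y_i}=\frac12\left[\binom{n+m-1}{m}+(-1)^m\binom{n}{m}\right]$$ and $$\sum_{\substack{\sum i y_i=m\\ \sum y_i\text{ odd}}}\prod_{i=1}^{m}\frac{1}{y_i!}\left(\frac{n}{i}\right)^{y_i}=\frac12\left[\binom{n+m-1}{m}-(-1)^m\binom{n}{m}\right],$$ where the sums run over the partitions $(y_1,\ldots,y_m)$ of $m$ for which $\sum y_i$ is even, respectively odd.
   Context: $\mathbb{N}=\{0,1,2,\ldots\}$. A partition of $m$ is represented by the tuple $(y_1,\ldots,y_m)$ of non-negative integers with $\sum_{i=1}^m i\,y_i=m$, and $\sum y_i$ denotes $\sum_{i=1}^m y_i$. For $m=0$ there is exactly one partition, the empty one, with $\sum y_i=0$. Empty products equal $1$, empty sums equal $0$, and $0^0=1$. Binomial coefficients satisfy $\binom{x}{0}=1$ for every integer $x$ (including $x=-1$) and $\binom{a}{b}=0$ for integers $0\le a<b$. *)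

(* Defs.v *)
From mathcomp Require Import all_boot all_order all_algebra.

Set Implicit Arguments.
Unset Strict Implicit.
Unset Printing Implicit Defensive.

(* [y] stands for the tuple (y_1, ..., y_m): the ordinal i : 'I_m carries the
   multiplicity y_(i+1) of the part i+1.  Multiplicities are bounded by m so that the
   partitions of m range over a finite type; by [mult_le] the bound excludes none. *)
Definition mults (m : nat) := {ffun 'I_m -> 'I_m.+1}.

Definition is_partition (m : nat) (y : mults m) : bool :=
  \sum_(i < m) i.+1 * y i == m.

Definition nparts (m : nat) (y : mults m) : nat := \sum_(i < m) y i.

Lemma mult_le (m : nat) (y : 'I_m -> nat) (i : 'I_m) :
  \sum_(j < m) j.+1 * y j = m -> y i <= m.
Proof.
move=> sum_y; rewrite -[leqRHS]sum_y (bigD1 i) //=.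
by rewrite (leq_trans _ (leq_addr _ _)) // leq_pmull.
Qed.

Import GRing.Theory.
Local Open Scope ring_scope.

Definition partition_weight (n m : nat) (y : mults m) : rat :=
  \prod_(i < m) ((y i)`!%:R^-1 * (n%:R / i.+1%:R) ^+ y i).

(* binom(n+m-1, m).  The truncated predecessor differs from n+m-1 only for
   n = m = 0, where 'C(0, 0) = 1 is the required value of binom(-1, 0). *)
Definition multichoose (n m : nat) : nat := 'C((n + m).-1, m).

(* Main.v *)
Require Import Defs.
From mathcomp Require Import all_boot all_order all_algebra.
From mathcomp Require Import ring.

Set Implicit Arguments.
Unset Strict Implicit.
Unset Printing Implicit Defensive.

Import GRing.Theory Num.Theory.
Local Open Scope ring_scope.

(** Let S(x) be the sum of (x / 1)^y_1 / y_1! * ... * (x / m)^y_m / y_m! over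
    all the partitions of m.  Replacing n by -n multiplies the weight of a
    partition by the sign (-1)^(y_1 + ... + y_m), so the even and the odd sums
    are half the sum and half the difference of S(n) and S(-n).  It remains to
    see that S(x) = x (x + 1) ... (x + m - 1) / m!
    ([sum_partition_weight_at]), whose values at n and -n are the two
    binomial coefficients, the second one with the sign (-1)^m.

    S(x) is the coefficient of X^m in the product over i <= m of the series
    exp (x X^i / i), that is, in exp (- x log (1 - X)) = (1 - X)^(-x) up to
    terms of higher degree.  To stay within polynomials, each exponential is
    truncated after the power m of its argument.  The logarithmic derivatives
    x X^(i - 1) of the factors are then correct modulo X^m, and so the product
    G satisfies the differential equation (1 - X) G' = x G of (1 - X)^(-x)
    modulo X^m ([partition_poly_ode]).  Read on coefficients, this is
    (j + 1) G_(j + 1) = (x + j) G_j for j < m, which determines G_m. *)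

Section GeneratingPolynomial.

Variable F : numFieldType.
Implicit Types (x : F) (p d l : {poly F}).

Definition partition_weight_at x m (y : mults m) : F :=
  \prod_(i < m) ((y i)`!%:R^-1 * (x / i.+1%:R) ^+ y i).

(** The exponential of x X^k / k for k = i + 1; the shift matches the
    indexing of the parts in [mults]. *)
Definition trunc_exp x (N i : nat) : {poly F} :=
  \sum_(j < N.+1) (j`!%:R^-1 * (x / i.+1%:R) ^+ j) *: 'X^(i.+1 * j).

Definition partition_poly x m : {poly F} := \prod_(i < m) trunc_exp x m i.

Lemma coef_partition_poly x m :
  (partition_poly x m)`_m
    = \sum_(y : mults m | is_partition y) partition_weight_at x y.
Proof.
rewrite /partition_poly /trunc_exp bigA_distr_bigA /= coef_sum.
rewrite [RHS]big_mkcond /=; apply: eq_bigr => y _.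
rewrite scaler_prod -expr_sum coefZ coefXn /is_partition eq_sym.
by case: eqP => _; rewrite ?mulr1 ?mulr0.
Qed.

(** Differentiating lowers each term of the exponential to x X^i times the
    previous one; only the last term, of degree at least N, is missed. *)
Lemma deriv_trunc_exp x N i :
  'X^N %| (trunc_exp x N i)^`() - (x *: 'X^i) * trunc_exp x N i.
Proof.
pose a j : F := j`!%:R^-1 * (x / i.+1%:R) ^+ j.
have aS j : a j.+1 * (i.+1 * j.+1)%:R = x * a j.
  rewrite /a factS !natrM exprS.
  have fact_neq0 : j`!%:R != 0 :> F by rewrite pnatr_eq0 -lt0n fact_gt0.
  have j_neq0 : j.+1%:R != 0 :> F by rewrite pnatr_eq0.
  have i_neq0 : i.+1%:R != 0 :> F by rewrite pnatr_eq0.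
  by field; rewrite fact_neq0 !nat1r i_neq0.
have -> : (trunc_exp x N i)^`()
    = (x *: 'X^i) * \sum_(j < N) a j *: 'X^(i.+1 * j).
  rewrite raddf_sum big_ord_recl /= muln0 expr0 derivZ derivC scaler0 add0r.
  rewrite mulr_sumr; apply: eq_bigr => j _.
  rewrite /bump add1n derivZ derivXn -scaler_nat scalerA -/(a j.+1) aS.
  by rewrite -scalerAl -scalerAr scalerA -exprD mulnSr addnS addnC.
rewrite -mulrBr /trunc_exp big_ord_recr /= -/(a N) opprD addrA subrr sub0r.
rewrite mulrN dvdpNr dvdp_mull // -mul_polyC dvdp_mull //.
by rewrite dvdp_exp2l // leq_pmull.
Qed.

(** Logarithmic derivatives add up, also modulo a polynomial d. *)
Lemma dvdp_logderiv_prod d (I : Type) (r : seq I) (p l : I -> {poly F}) :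
  (forall i, d %| (p i)^`() - l i * p i) ->
  d %| (\prod_(i <- r) p i)^`() - (\sum_(i <- r) l i) * \prod_(i <- r) p i.
Proof.
move=> d_p; elim: r => [|i r IHr].
  by rewrite !big_nil derivC mul0r subr0 dvdp0.
rewrite !big_cons derivM.
set P := \prod_(_ <- _) _ in IHr *; set L := \sum_(_ <- _) _ in IHr *.
have -> : (p i)^`() * P + p i * P^`() - (l i + L) * (p i * P)
    = ((p i)^`() - l i * p i) * P + p i * (P^`() - L * P) by ring.
by apply: dvdp_add; [apply: dvdp_mulr | apply: dvdp_mull].
Qed.

(** The logarithmic derivative is x (1 + X + ... + X^(m - 1)), which
    multiplication by 1 - X turns into x (1 - X^m). *)
Lemma partition_poly_ode x m :
  'X^m %| (1 - 'X) * (partition_poly x m)^`() - x *: partition_poly x m.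
Proof.
have := @dvdp_logderiv_prod 'X^m _ (index_enum 'I_m) (fun i => trunc_exp x m i)
  (fun i => x *: 'X^i) (fun i => deriv_trunc_exp x m i).
rewrite -/(partition_poly x m) -scaler_sumr.
set G := partition_poly x m; set s := \sum_(_ < _) _ => dvd_G.
have geom : 'X^m = 1 - (1 - 'X) * s.
  by rewrite -mulNr opprB -subrX1 addrC subrK.
have -> : (1 - 'X) * G^`() - x *: G
    = (1 - 'X) * (G^`() - x *: s * G) - x *: ('X^m * G).
  by rewrite geom -!mul_polyC; ring.
rewrite dvdp_sub ?dvdp_mull //.
by rewrite -mul_polyC dvdp_mull // dvdp_mulr.
Qed.

Lemma coef_partition_polyS x m j : (j < m)%N ->
  j.+1%:R * (partition_poly x m)`_j.+1 = (x + j%:R) * (partition_poly x m)`_j.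
Proof.
move=> lt_jm; have /dvdpP[q /(congr1 (fun p : {poly F} => p`_j))] :=
  partition_poly_ode x m.
rewrite coefMXn lt_jm coefB coefZ mulrBl mul1r coefB coefXM !coef_deriv.
case: j lt_jm => [|j] _ /= /eqP; rewrite ?subr0 subr_eq0 ?subr_eq => /eqP.
  by rewrite addr0 mulr1n mul1r.
by rewrite !mulr_natl mulrDl mulr_natl.
Qed.

Lemma coef0_partition_poly x m : (partition_poly x m)`_0 = 1.
Proof.
rewrite -horner_coef0 horner_prod big1 // => i _.
rewrite /trunc_exp horner_sum big_ord_recl big1 => [|j _].
  by rewrite muln0 !expr0 !hornerE fact0 invr1.
by rewrite hornerZ hornerXn expr0n mulr0.
Qed.

(** The closed form enters through its recurrence, so that both binomial
    coefficients can be substituted without rewriting them as products. *)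
Lemma sum_partition_weight_at x m (c : nat -> F) :
  c 0 = 1 -> (forall j, j.+1%:R * c j.+1 = (x + j%:R) * c j) ->
  \sum_(y : mults m | is_partition y) partition_weight_at x y = c m.
Proof.
move=> c0 cS; rewrite -coef_partition_poly.
have coefE j : (j <= m)%N -> (partition_poly x m)`_j = c j.
  elim: j => [|j IHj] le_jm; first by rewrite coef0_partition_poly c0.
  have j_neq0 : j.+1%:R != 0 :> F by rewrite pnatr_eq0.
  by apply: (mulfI j_neq0); rewrite coef_partition_polyS // IHj ?cS // ltnW.
exact: coefE.
Qed.

Lemma sum_partition_weight_nat n m :
  \sum_(y : mults m | is_partition y) partition_weight_at n%:R y
    = (multichoose n m)%:R.
Proof.
apply: (@sum_partition_weight_at _ _ (fun j => (multichoose n j)%:R)).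
  by rewrite /multichoose bin0.
by move=> j; rewrite -natrD -!natrM /multichoose addnS -mul_bin_diag.
Qed.

Lemma sum_partition_weight_opp_nat n m :
  \sum_(y : mults m | is_partition y) partition_weight_at (- n%:R) y
    = (-1) ^+ m * 'C(n, m)%:R.
Proof.
apply: (@sum_partition_weight_at _ _ (fun j => (-1) ^+ j * 'C(n, j)%:R)).
  by rewrite expr0 bin0 mulr1.
move=> j; rewrite mulrCA -natrM mul_bin_left natrM exprS.
have [le_jn | lt_nj] := leqP j n; first by rewrite natrB //; ring.
by rewrite bin_small // !mulr0.
Qed.

End GeneratingPolynomial.

Lemma partition_weight_atN n m (y : mults m) :
  partition_weight_at (- n%:R) y
    = (-1) ^+ odd (nparts y) * partition_weight n y.
Proof.
rewrite signr_odd /nparts expr_sum -big_split /=; apply: eq_bigr => i _.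
by rewrite mulNr [(- (_ / _)) ^+ _]exprNn mulrCA.
Qed.

Theorem theorem6p4 (m n : nat) :
  \sum_(y : mults m | is_partition y && ~~ odd (nparts y)) partition_weight n y
    = 2%:R^-1 * ((multichoose n m)%:R + (-1) ^+ m * 'C(n, m)%:R)
  /\
  \sum_(y : mults m | is_partition y && odd (nparts y)) partition_weight n y
    = 2%:R^-1 * ((multichoose n m)%:R - (-1) ^+ m * 'C(n, m)%:R).
Proof.
set E := \sum_(y | _ && ~~ _) _; set O := \sum_(y | _ && odd _) _.
have EaddO : (multichoose n m)%:R = O + E.
  rewrite -sum_partition_weight_nat.
  by rewrite (bigID (fun y : mults m => odd (nparts y))).
have EsubO : (-1) ^+ m * 'C(n, m)%:R = - O + E.
  rewrite -sum_partition_weight_opp_nat.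
  rewrite (bigID (fun y : mults m => odd (nparts y))) /= -sumrN.
  congr (_ + _); apply: eq_bigr => y /andP[_].
    by rewrite partition_weight_atN => ->; rewrite mulN1r.
  by rewrite partition_weight_atN => /negPf->; rewrite mul1r.
by rewrite EaddO EsubO; split; field.
Qed.
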